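(* Let $a\in\mathbb{N}$ with $a\geq 2$ and $b,c\in\mathbb{N}$ with $b+c>a$. Then the curve $$C_{b,c}:\quad x^a+y^a+x^by^c=0$$ has an ordinary singularity of multiplicity $a$ at $O=(0,0)$, and, under the assumption $b\geq c$, the possible values for its Tjurina number $\tau$ at $O$ are: $$ \tau=\begin{cases} (a-1)^2 & \text{if } b\geq a, \text{ or } b=a-1,\ c\geq \frac a2,\\ b(a-1)+c(a+1)-bc-a+1 & \text{if } \frac{a+1}{2}<b\leq a-1,\ c\leq \frac{a-1}{2},\\ b(a-1)+c(a+1)-bc-a & \text{if } \frac{a+1}{2}<b<a-1,\ c=\frac a2,\\ b(a-1)+c(a-1)-bc & \text{if } \frac{a+1}{2}\leq b<a-1,\ \frac{a+1}{2}\leq c<a-1. \end{cases} $$ The minimum value reached by the Tjurina number $\tau$ of $C_{b,c}$ at $O$ is $$\tau_a:=\min_{b,c\in\mathbb{N},\ b+c>a}\{\tau(C_{b,c})_O\}=\left\lfloor\frac{3a^2-2a-4}{4}\right\rfloor,$$ and the curves realizing this minimum are, if we ask $b\geq c$, $x^a+y^a+x^{\frac a2+1}y^{\frac a2}=0$ for $a$ even and $x^a+y^a+x^{\frac{a+1}{2}}y^{\frac{a+1}{2}}=0$ for $a$ odd.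
   Context: $\mathbb{N}$ denotes the non-negative integers, and curves are plane curves in $\mathbb{A}^2$ over $\mathbb{C}$. For a reduced curve $C:f(x,y)=0$ in $\mathbb{A}^2$ the Jacobian ideal is $J=(f,f_x,f_y)\subset\mathbb{C}[x,y]$ and the Jacobian scheme $X(C)$ is the $0$-dimensional subscheme of $\mathbb{A}^2$ defined by $J$. For a singular point $P$ of $C$, $X_P$ is the component of $X(C)$ supported at $P$, and the Tjurina number $\tau(C)_P$ of $C$ at $P$ is the length of $X_P$, i.e. $\dim_{\mathbb{C}}\mathbb{C}[x,y]_{\mathfrak{m}_P}/J\,\mathbb{C}[x,y]_{\mathfrak{m}_P}$, where $\mathfrak m_P$ is the maximal ideal of $P$. An ordinary singularity of multiplicity $a$ is a point of multiplicity $a$ at which the tangent cone of the curve consists of $a$ distinct lines.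
   Formalization: That the named curves are the only ones with b ≥ c realizing the minimum is asserted only for a ≥ 5; for a = 2, 3, 4 it is false, since every C_{b,c} then has τ = (a−1)² = τ_a (e.g. x²+y²+x³ for a = 2). That they realize the minimum is stated for all a ≥ 2. *)

(* Defs.v *)
From mathcomp Require Import all_boot all_order all_algebra.
From mathcomp Require Import mpoly.

Set Implicit Arguments.
Unset Strict Implicit.
Unset Printing Implicit Defensive.

Import GRing.Theory.
Local Open Scope ring_scope.

(* Plane affine curves f = 0 over a field F are given by their equation
   f : {mpoly F[2]}; the coordinates x and y are 'X_0 and 'X_1, and a point is
   a valuation P : 'I_2 -> F of the two variables. *)

Section PlaneCurves.
Variable F : fieldType.
Local Notation S := {mpoly F[2]}.
Local Notation "p %:F" := (@tofrac S p).
Implicit Types (f : S) (P : 'I_2 -> F) (h : {fraction S}).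

Definition origin : 'I_2 -> F := fun=> 0.

(* The equation f(x + P_0, y + P_1) of the curve with P moved to the origin. *)
Definition translate f P : S :=
  f \mPo [tuple 'X_i + (P i)%:MP | i < 2].

Definition tangent_cone f P (m : nat) : S := pihomog mdeg m (translate f P).

Definition multiplicity_at f P (m : nat) : Prop :=
  tangent_cone f P m <> 0 /\ forall d, (d < m)%N -> tangent_cone f P d = 0.

(* The tangent cone at a point of multiplicity m is a binary form of degree m;
   it consists of m distinct lines when it is a product of m pairwise
   non-proportional linear forms. *)
Definition ordinary_singularity f P (m : nat) : Prop :=
  multiplicity_at f P m /\
  exists l : 'I_m -> S,
    [/\ forall i, l i \is 1.-homog,
        forall i j (k : F), l i = k *: l j -> i = j
      & tangent_cone f P m = \prod_(i < m) l i].

(* The local ring F[x, y]_(m_P), inside the fraction field F(x, y). *)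
Definition in_local_ring P h : Prop :=
  exists p q : S, q.@[P] <> 0 /\ h = p%:F / q%:F.

(* The extension of the Jacobian ideal (f, f_x, f_y) to the local ring at P. *)
Definition in_local_jacobian f P h : Prop :=
  exists u v w : {fraction S},
    [/\ in_local_ring P u, in_local_ring P v, in_local_ring P w
      & h = u * f%:F + v * (f^`M(0))%:F + w * (f^`M(1))%:F].

(* The quotient of the local ring by the extended Jacobian ideal has dimension
   n over F: the classes of some e_0, ..., e_(n-1) form a basis of it. *)
Definition tjurina_number f P (n : nat) : Prop :=
  exists e : 'I_n -> {fraction S},
    (forall i, in_local_ring P (e i)) /\
    forall h, in_local_ring P h ->
      exists! c : {ffun 'I_n -> F},
        in_local_jacobian f P (h - \sum_(i < n) ((c i)%:MP)%:F * e i).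

Lemma in_local_ringC P (k : F) : in_local_ring P (k%:MP)%:F.
Proof.
exists k%:MP, 1; split; first by rewrite meval1; apply/eqP/oner_neq0.
by rewrite tofrac1 divr1.
Qed.

Lemma in_local_ringM P g h :
  in_local_ring P g -> in_local_ring P h -> in_local_ring P (g * h).
Proof.
move=> [p1 [q1 [nz1 ->]]] [p2 [q2 [nz2 ->]]]; exists (p1 * p2), (q1 * q2).
split; first by rewrite mevalM; apply/eqP; rewrite mulf_neq0 //; apply/eqP.
by rewrite !rmorphM invfM mulrACA.
Qed.

Lemma in_local_ringD P g h :
  in_local_ring P g -> in_local_ring P h -> in_local_ring P (g + h).
Proof.
move=> [p1 [q1 [nz1 ->]]] [p2 [q2 [nz2 ->]]].
have q_neq0 q : q.@[P] <> 0 -> q%:F != 0.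
  by move=> nz; rewrite tofrac_eq0; apply/eqP => q0; apply: nz; rewrite q0 meval0.
exists (p1 * q2 + p2 * q1), (q1 * q2).
split; first by rewrite mevalM; apply/eqP; rewrite mulf_neq0 //; apply/eqP.
by rewrite addf_div ?q_neq0 // rmorphD !rmorphM.
Qed.

Lemma in_local_jacobian0 f P : in_local_jacobian f P 0.
Proof.
have O0 := in_local_ringC P 0; rewrite mpolyC0 tofrac0 in O0.
by exists 0, 0, 0; split=> //; rewrite !mul0r !addr0.
Qed.

Lemma in_local_jacobianD f P g h :
  in_local_jacobian f P g -> in_local_jacobian f P h ->
  in_local_jacobian f P (g + h).
Proof.
move=> [u1 [v1 [w1 [Hu1 Hv1 Hw1 ->]]]] [u2 [v2 [w2 [Hu2 Hv2 Hw2 ->]]]].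
exists (u1 + u2), (v1 + v2), (w1 + w2).
split; do ?exact: in_local_ringD.
by rewrite !mulrDl addrACA; congr (_ + _); rewrite addrACA.
Qed.

Lemma in_local_jacobianZ f P (k : F) h :
  in_local_jacobian f P h -> in_local_jacobian f P ((k%:MP)%:F * h).
Proof.
move=> [u [v [w [Hu Hv Hw ->]]]]; have Hk := in_local_ringC P k.
exists ((k%:MP)%:F * u), ((k%:MP)%:F * v), ((k%:MP)%:F * w).
by split; do ?exact: in_local_ringM; rewrite !mulrDr !mulrA.
Qed.

Lemma tjurina_number_le f P (m n : nat) :
  tjurina_number f P m -> tjurina_number f P n -> (m <= n)%N.
Proof.
move=> [d [Hd basis_d]] [e [He basis_e]].
have /fin_all_exists [A HA] i := basis_e _ (Hd i).
have /fin_all_exists [B HB] j := basis_d _ (He j).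
pose MA : 'M[F]_(m, n) := \matrix_(i, j) A i j.
pose MB : 'M[F]_(n, m) := \matrix_(i, j) B i j.
apply: (@mulmx1_min _ _ _ MA MB); apply/matrixP => i k.
have [c [_ c_uniq]] := basis_d _ (Hd i).
have eq1 : c = [ffun k => (MA *m MB) i k].
  apply: c_uniq; rewrite (_ : d i - _ =
    (d i - \sum_(j < n) ((A i j)%:MP)%:F * e j) +
    \sum_(j < n) ((A i j)%:MP)%:F * (e j - \sum_(l < m) ((B j l)%:MP)%:F * d l)).
    apply: in_local_jacobianD; first by case: (HA i).
    apply: big_ind => [|g h|j _]; first exact: in_local_jacobian0.
      exact: in_local_jacobianD.
    by apply: in_local_jacobianZ; case: (HB j).
  rewrite [X in _ = _ + X](eq_bigr (fun j => ((A i j)%:MP)%:F * e j -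
     \sum_(l < m) ((A i j)%:MP)%:F * (((B j l)%:MP)%:F * d l))); last first.
    by move=> j _; rewrite mulrBr mulr_sumr.
  rewrite sumrB addrA subrK; congr (_ - _); rewrite exchange_big /=.
  apply: eq_bigr => l _; rewrite ffunE mxE !rmorph_sum mulr_suml.
  by apply: eq_bigr => j _; rewrite !mxE mulrA !rmorphM.
have eq2 : c = [ffun k => (i == k)%:R].
  apply: c_uniq; rewrite (bigD1 i) //= ffunE eqxx big1 => [|j ij].
    by rewrite !rmorph1 mul1r addr0 subrr; apply: in_local_jacobian0.
  by rewrite ffunE eq_sym (negPf ij) !rmorph0 mul0r.
have := congr1 (fun g : {ffun _ -> _} => g k) (etrans (esym eq1) eq2).
by rewrite !ffunE => ->; rewrite mxE.
Qed.

Lemma tjurina_number_unique f P (m n : nat) :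
  tjurina_number f P m -> tjurina_number f P n -> m = n.
Proof.
by move=> Hm Hn; apply/eqP; rewrite eqn_leq !(tjurina_number_le (f := f) (P := P)).
Qed.

(* x^a + y^a + x^b y^c *)
Definition curve (a b c : nat) : S :=
  'X_0 ^+ a + 'X_1 ^+ a + 'X_0 ^+ b * 'X_1 ^+ c.

End PlaneCurves.

(* Main.v *)
Require Import Defs.
From HB Require Import structures.
From mathcomp Require Import all_boot all_order all_algebra all_field.
From mathcomp Require Import ring zify.
From mathcomp Require Import reals complex mpoly.

(** Write f = x^a + y^a + x^b y^c with c <= b; exchanging the coordinates covers
    the other case.  Euler's identity gives
      x f_x + y f_y - a f = (b + c - a) x^b y^c,
    and b + c > a, so in characteristic 0 the Jacobian ideal is generated by
    the binomials f_x, f_y and the monomial x^b y^c.  An ideal generated by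
    binomials and monomials admits a reduction sending each monomial to a
    scalar multiple of a monomial.  Here x^(a-1) rewrites to a multiple of
    x^(b-1) y^c, y^(a-1) to a multiple of x^b y^(c-1), and x^b y^c to 0;
    multiplying f_x by y^c gives one more relation that shapes the quotient,
    namely x^(b-1) y^(2c) = 0 when b < a.  When b >= a the derivative f_x is
    x^(a-1) times a unit of the local ring, and the ideal is simply
    (x^(a-1), y^(a-1)).  In every case the monomials that survive are those
    with i < a - 1 lying under a staircase with at most three levels (height,
    standard).

    The definition of the Tjurina number speaks of fractions, the reduction of
    polynomials.  Lemma tjurina_number_normal_form connects them: a linear
    normal form congruent to the identity, fixing the standard monomials, and
    vanishing on the Jacobian ideal and on all polynomials of high order shows
    that the standard monomials are a basis of the local quotient.  The
    congruences give spanning, the vanishing gives independence.  Hence the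
    Tjurina number is the area of the staircase (tjurina_number_bicurve).

    The rest is arithmetic.  For b < a and 2 c >= a the area is
    (a-1)^2 - (a-1-b)(a-1-c), so minimising it means maximising the product of
    two integers whose sum is at most a - 3, which requires them to be as equal
    as possible; the other regimes never do better.  Finally the tangent cone
    of f at the origin is x^a + y^a, which is the product of the lines
    x - z y over the a distinct roots z of X^a + 1. *)

Set Implicit Arguments.
Unset Strict Implicit.
Unset Printing Implicit Defensive.

Import Order.TTheory GRing.Theory Num.Theory.
Local Open Scope ring_scope.

(** * The local ring at the origin and its Jacobian ideal *)

Lemma clear_denominators (K : fieldType) (a0 a1 a2 b0 b1 b2 k0 k1 k2 : K) :
  a0 != 0 -> a1 != 0 -> a2 != 0 ->
  a0 * a1 * a2 * (b0 / a0 * k0 + b1 / a1 * k1 + b2 / a2 * k2) =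
  b0 * a1 * a2 * k0 + b1 * a0 * a2 * k1 + b2 * a0 * a1 * k2.
Proof. by move=> nz0 nz1 nz2; field; rewrite nz0 nz1 nz2. Qed.

Lemma subf_div_mul (K : fieldType) (p q s : K) :
  q != 0 -> p / q - p * s = 1 / q * ((1 - q * s) * p).
Proof. by move=> nz; field. Qed.

Section LocalRing.
Variable F : fieldType.
Local Notation S := {mpoly F[2]}.
Local Notation "p %:F" := (@tofrac S p).
Local Notation O := (origin F).
Implicit Types (f p q r : S) (P : 'I_2 -> F) (h : {fraction S}) (N : nat).

Lemma in_local_ring_poly P p : in_local_ring P p%:F.
Proof.
exists p, 1; split; first by rewrite meval1; apply/eqP/oner_neq0.
by rewrite tofrac1 divr1.
Qed.

Lemma in_local_ringV P p q : q.@[P] != 0 -> in_local_ring P (p%:F / q%:F).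
Proof. by move=> q_neq0; exists p, q; split=> //; apply/eqP. Qed.

Lemma tofrac_neq0_of_meval P q : q.@[P] != 0 -> q%:F != 0.
Proof. by apply: contraNneq => /eqP; rewrite tofrac_eq0 => /eqP ->; rewrite meval0. Qed.

Lemma in_local_jacobianM f P g h :
  in_local_ring P g -> in_local_jacobian f P h -> in_local_jacobian f P (g * h).
Proof.
move=> Hg [u [v [w [Hu Hv Hw ->]]]]; exists (g * u), (g * v), (g * w).
by split; do ?exact: in_local_ringM; rewrite !mulrDr !mulrA.
Qed.

Lemma in_local_jacobianB f P g h :
  in_local_jacobian f P g -> in_local_jacobian f P h ->
  in_local_jacobian f P (g - h).
Proof.
move=> Jg Jh; apply: in_local_jacobianD => //.
by have := in_local_jacobianZ (- 1) Jh; rewrite !rmorphN !rmorph1 mulN1r.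
Qed.

(** The preimage in the polynomial ring of the local Jacobian ideal: membership
    can be computed with polynomials, yet units of the local ring cancel. *)
Definition jacobian_contraction f P p := in_local_jacobian f P p%:F.

Section Contraction.
Variables (f : S) (P : 'I_2 -> F).
Local Notation J := (jacobian_contraction f P).

Lemma jacobian_contractionD p q : J p -> J q -> J (p + q).
Proof. by rewrite /jacobian_contraction rmorphD; apply: in_local_jacobianD. Qed.

Lemma jacobian_contractionMl p q : J q -> J (p * q).
Proof.
rewrite /jacobian_contraction rmorphM.
exact: in_local_jacobianM (in_local_ring_poly P p).
Qed.

Lemma jacobian_contraction0 : J 0.
Proof. by rewrite /jacobian_contraction rmorph0; apply: in_local_jacobian0. Qed.

Lemma jacobian_contractionZ k p : J p -> J (k *: p).
Proof. by rewrite -mul_mpolyC; apply: jacobian_contractionMl. Qed.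

Lemma jacobian_contractionN p : J p -> J (- p).
Proof. by rewrite -scaleN1r; apply: jacobian_contractionZ. Qed.

Lemma jacobian_contractionB p q : J p -> J q -> J (p - q).
Proof.
by move=> Jp Jq; apply/jacobian_contractionD/jacobian_contractionN.
Qed.

Lemma jacobian_contraction_curve : J f.
Proof.
exists 1, 0, 0; rewrite -tofrac1 -tofrac0; split; do ?exact: in_local_ring_poly.
by rewrite -!rmorphM -!rmorphD mul1r !mul0r !addr0.
Qed.

Lemma jacobian_contraction_deriv i : J f^`M(i).
Proof.
exists 0, (i == 0)%:R%:F, (i == 1)%:R%:F.
split; first by rewrite -tofrac0; apply: in_local_ring_poly.
- exact: in_local_ring_poly.
- exact: in_local_ring_poly.
rewrite mul0r add0r -!rmorphM -rmorphD; congr (_%:F).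
case: i => [[|[|//]] ltn2].
  by rewrite mul1r mul0r addr0; congr mderiv; apply: val_inj.
by rewrite mul1r mul0r add0r; congr mderiv; apply: val_inj.
Qed.

(** A polynomial not vanishing at P is a unit of the local ring. *)
Lemma jacobian_contraction_unit p q : q.@[P] != 0 -> J (q * p) -> J p.
Proof.
move=> q_neq0 Jqp; rewrite /jacobian_contraction.
rewrite (_ : p%:F = (1%:F / q%:F) * (q * p)%:F).
  exact: in_local_jacobianM (in_local_ringV _ q_neq0) _.
by rewrite tofrac1 mul1r rmorphM mulKf // (tofrac_neq0_of_meval q_neq0).
Qed.

End Contraction.

(** Membership of p in the N-th power of the maximal ideal of the origin. *)
Definition order_ge N p := forall m, (mdeg m < N)%N -> p@_m = 0.

Lemma order_geM M N p q : order_ge M p -> order_ge N q -> order_ge (M + N) (p * q).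
Proof.
move=> ord_p ord_q m ltm; rewrite mcoeffM big1 // => -[m1 m2] /= /eqP defm.
have := ltm; rewrite {1}defm mdegD.
have [lt1 _|le1 lt12] := ltnP (mdeg m1) M; first by rewrite ord_p ?mul0r.
by rewrite ord_q ?mulr0 // -(ltn_add2l M) (leq_ltn_trans _ lt12) ?leq_add2r.
Qed.

Lemma order_geX N p : order_ge 1 p -> order_ge N (p ^+ N).
Proof.
move=> ord_p; elim: N => [|N IHN]; first by move=> m; rewrite ltn0.
by rewrite exprS -add1n; apply: order_geM.
Qed.

Lemma meval_origin p : p.@[O] = p@_0%MM.
Proof.
rewrite mevalE [in RHS](mpolyE p) raddf_sum; apply: eq_bigr => m _.
rewrite /= mcoeffZ mcoeffX; congr (_ * _).
have [->|] := eqVneq m 0%MM.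
  by rewrite big1 // => i _; rewrite mnm0E expr0.
rewrite -mdeg_eq0 mdegE sum_nat_eq0 negb_forall => /existsP[i /= mi].
by rewrite (bigD1 i) //= expr0n (negPf mi) mul0r.
Qed.

Lemma order_ge1 p : p.@[O] = 0 -> order_ge 1 p.
Proof.
rewrite meval_origin => p0 m.
by rewrite ltnS leqn0 mdeg_eq0 => /eqP ->.
Qed.

(** Writing q as a constant times 1 - t with t of positive order, a truncated
    geometric series in t is an inverse of q modulo t^N. *)
Lemma inverse_up_to_order N q :
  q.@[O] != 0 -> exists q' r, order_ge N r /\ q * q' = 1 - r.
Proof.
move=> q_neq0; pose k := (q.@[O])^-1; pose t : S := 1 - k *: q.
exists (k *: \sum_(i < N) t ^+ i), (t ^+ N); split.
  apply/order_geX/order_ge1.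
  by rewrite mevalB meval1 mevalZ mulVf // subrr.
rewrite -scalerAr scalerAl.
have -> : k *: q = 1 - t by rewrite subKr.
by rewrite -(opprB t 1) mulNr -subrX1 opprB.
Qed.

(** The map NF computes remainders modulo the Jacobian ideal, read off on the
    monomials of ms.  Clearing denominators reduces the local statement to
    polynomials, because a denominator not vanishing at the origin can be
    inverted up to terms of arbitrarily high order, which NF does not see. *)
Lemma tjurina_number_normal_form f (NF : {linear S -> S})
    (ms : seq 'X_{1..2}) N :
  uniq ms ->
  (forall p, jacobian_contraction f O (p - NF p)) ->
  (forall m, m \in ms -> NF 'X_[m] = 'X_[m]) ->
  (forall p m, m \notin ms -> (NF p)@_m = 0) ->
  (forall p, NF (p * f) = 0) ->
  (forall p i, NF (p * f^`M(i)) = 0) ->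
  (forall p, order_ge N p -> NF p = 0) ->
  tjurina_number f O (size ms).
Proof.
move=> ms_uniq NF_congr NF_id NF_supp NF_f NF_df NF_ord.
pose e (k : 'I_(size ms)) := nth 0%MM ms k; pose X k : S := 'X_[e k].
have e_inj : injective e.
  move=> k l /eqP; rewrite /e nth_uniq // => /eqP; exact: val_inj.
have sum_e (c : {ffun 'I_(size ms) -> F}) k : (\sum_l c l *: X l)@_(e k) = c k.
  rewrite raddf_sum (bigD1 k) //= big1 => [|l lk].
    by rewrite mcoeffZ mcoeffX eqxx mulr1 addr0.
  by rewrite mcoeffZ mcoeffX (inj_eq e_inj) (negPf lk) mulr0.
have NF_sum p : NF p = \sum_k (NF p)@_(e k) *: X k.
  apply/mpolyP=> m; have [m_ms|m_ms] := boolP (m \in ms); last first.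
    rewrite NF_supp // raddf_sum big1 // => k _ /=; rewrite mcoeffZ mcoeffX.
    case: eqP => [em|]; last by rewrite mulr0.
    by case/negP: m_ms; rewrite -em mem_nth.
  have lt_m : (index m ms < size ms)%N by rewrite index_mem.
  have -> : m = e (Ordinal lt_m) by rewrite /e nth_index.
  have := sum_e [ffun k => (NF p)@_(e k)] (Ordinal lt_m).
  by rewrite ffunE => {1}<-; congr (_@__); apply: eq_bigr => k _; rewrite ffunE.
have NF_comb (c : {ffun 'I_(size ms) -> F}) :
    NF (\sum_k c k *: X k) = \sum_k c k *: X k.
  rewrite linear_sum; apply: eq_bigr => k _.
  by rewrite linearZ /= NF_id // mem_nth.
have comb_frac (c : {ffun 'I_(size ms) -> F}) :
    \sum_k ((c k)%:MP)%:F * (X k)%:F = (\sum_k c k *: X k)%:F.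
  by rewrite rmorph_sum; apply: eq_bigr => k _; rewrite -mul_mpolyC rmorphM.
(* With q the product of the denominators, q * p is in the polynomial Jacobian
   ideal; multiplying by an approximate inverse of q recovers p up to a term
   of order at least N, which NF kills as well. *)
have NF_jac p : jacobian_contraction f O p -> NF p = 0.
  move=> [_ [_ [_ [[u [qu [/eqP nu ->]]] [v [qv [/eqP nv ->]]]
    [w [qw [/eqP nw ->]]] eq_p]]]].
  have nz q : q.@[O] != 0 -> q%:F != 0 := @tofrac_neq0_of_meval O q.
  pose q := qu * qv * qw.
  have nq : q.@[O] != 0 by rewrite !mevalM !mulf_neq0.
  have {eq_p} eq_p : q * p =
      (u * qv * qw) * f + (v * qu * qw) * f^`M(0) + (w * qu * qv) * f^`M(1).
    apply/eqP; rewrite -tofrac_eq; apply/eqP; rewrite !tofracD !tofracM eq_p.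
    exact: (clear_denominators _ _ _ _ _ _ (nz _ nu) (nz _ nv) (nz _ nw)).
  have [q' [r [ord_r qq']]] := inverse_up_to_order N nq.
  have -> : p = q' * (q * p) + r * p.
    by rewrite mulrA [q' * q]mulrC qq' mulrBl mul1r subrK.
  rewrite eq_p !mulrDr !mulrA !linearD /= NF_f !NF_df !add0r NF_ord //.
  by rewrite -[N]addn0; apply: order_geM.
exists (fun k => (X k)%:F); split=> [k|]; first exact: in_local_ring_poly.
move=> _ [p [q [/eqP nq ->]]].
have [q' [r [ord_r qq']]] := inverse_up_to_order N nq.
have Jr : in_local_jacobian f O (p%:F / q%:F - (p * q')%:F).
  rewrite (_ : _ - _ = (1%:F / q%:F) * (r * p)%:F).
    apply: in_local_jacobianM; first exact: in_local_ringV.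
    have := NF_congr (r * p); rewrite NF_ord ?subr0 //.
    by rewrite -[N]addn0; apply: order_geM.
  have -> : r = 1 - q * q' by rewrite qq' subKr.
  rewrite !tofracM tofracB tofracM tofrac1.
  exact: (subf_div_mul _ _ (tofrac_neq0_of_meval nq)).
exists [ffun k => (NF (p * q'))@_(e k)]; split.
  rewrite comb_frac (eq_bigr _ (fun k _ => congr1 (fun t => t *: X k) (ffunE _ k))).
  rewrite -NF_sum -[p%:F / _](subrK (p * q')%:F) -addrA -rmorphB.
  by apply: in_local_jacobianD; last exact: NF_congr.
move=> c; rewrite comb_frac => Jc; apply/ffunP=> k; rewrite ffunE.
rewrite -[RHS]sum_e; congr (_@__); apply/eqP; rewrite -NF_comb -subr_eq0.
rewrite -linearB; apply/eqP/NF_jac; rewrite /jacobian_contraction tofracB.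
by have := in_local_jacobianB Jc Jr; rewrite opprB addrC addrA subrK.
Qed.
End LocalRing.

(** * The staircase of standard monomials *)

Section Staircase.
Variables a b c : nat.

(** The number of standard monomials x^i y^j in column i.  The middle value
    comes from the relation x^(b-1) y^(2c) = 0, the last one from x^b y^c = 0;
    for b >= a neither is reached by a column i < a - 1, so the same formula
    describes the full square of side a - 1. *)
Definition height i : nat :=
  if (i < b.-1)%N then a.-1 else if i == b.-1 then minn a.-1 (2 * c) else c.

Definition standard i j := (i < a.-1)%N && (j < height i)%N.

Lemma standardE i j : standard i j =
  (i < a.-1)%N && [|| (i < b.-1) && (j < a.-1),
    [&& i == b.-1, j < a.-1 & j < 2 * c] | (b.-1 < i) && (j < c)]%N.
Proof. by rewrite /standard /height; case: (ltngtP i b.-1) => /= ?; lia. Qed.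

Definition staircase_area : nat := \sum_(0 <= i < a.-1) height i.

End Staircase.

(** * Reduction modulo the Jacobian ideal *)

Section NormalForm.
Variables (F : fieldType) (p q : 'I_2) (a b c : nat).
Hypotheses (char0 : [pchar F] =i pred0) (pq : p != q).
Hypotheses (a_ge2 : (2 <= a)%N) (cb : (c <= b)%N) (abc : (a < b + c)%N).
Local Notation S := {mpoly F[2]}.
Local Notation O := (origin F).

(** The two coordinates are called p and q rather than 0 and 1, so that the
    assumption c <= b costs no generality: for b < c the roles of p and q are
    exchanged. *)
Definition bimonomial i j : 'X_{1..2} := (U_(p) *+ i + U_(q) *+ j)%MM.
Local Notation X i j := ('X_[bimonomial i j] : S).

Lemma bimonomial_p i j : bimonomial i j p = i.
Proof. by rewrite mnmDE !mulmnE !mnm1E eqxx eq_sym (negPf pq) mul1n mul0n addn0. Qed.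

Lemma bimonomial_q i j : bimonomial i j q = j.
Proof. by rewrite mnmDE !mulmnE !mnm1E eqxx (negPf pq) mul1n mul0n. Qed.

Lemma ord2_pq (P : 'I_2 -> Prop) : P p -> P q -> forall i, P i.
Proof.
move=> Pp Pq i; have [->//|ip] := eqVneq i p.
suff -> : i = q by [].
apply/val_inj; move: (ltn_ord i) (ltn_ord p) (ltn_ord q) ip pq.
by rewrite -!val_eqE /=; lia.
Qed.

Lemma bimonomialE (m : 'X_{1..2}) : m = bimonomial (m p) (m q).
Proof. by apply/mnmP; apply: ord2_pq; rewrite ?bimonomial_p ?bimonomial_q. Qed.

Lemma bimonomialD i j k l :
  (bimonomial i j + bimonomial k l)%MM = bimonomial (i + k) (j + l).
Proof.
by apply/mnmP; apply: ord2_pq; rewrite mnmDE ?bimonomial_p ?bimonomial_q.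
Qed.

Lemma bimonomialM i j k l : X i j * X k l = X (i + k) (j + l).
Proof. by rewrite -mpolyXD bimonomialD. Qed.

Lemma bimonomial_inj i j k l : bimonomial i j = bimonomial k l -> (i, j) = (k, l).
Proof.
move=> eqm; have := congr1 (fun m : 'X_{1..2} => m p) eqm.
have := congr1 (fun m : 'X_{1..2} => m q) eqm.
by rewrite /= !bimonomial_p !bimonomial_q => -> ->.
Qed.

Lemma mdeg_bimonomial i j : mdeg (bimonomial i j) = (i + j)%N.
Proof. by rewrite mdegD !mdegMn !mdeg1 !mul1n. Qed.

Lemma deriv_bimonomial_p i j : (X i j)^`M(p) = i%:R *: X i.-1 j.
Proof.
rewrite mderivX bimonomial_p; congr (_ *: 'X_[_]).
apply/mnmP; apply: ord2_pq; rewrite mnmBE mnm1E ?bimonomial_p ?bimonomial_q.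
  by rewrite eqxx subn1.
by rewrite (negPf pq) subn0.
Qed.

Lemma deriv_bimonomial_q i j : (X i j)^`M(q) = j%:R *: X i j.-1.
Proof.
rewrite mderivX bimonomial_q; congr (_ *: 'X_[_]).
apply/mnmP; apply: ord2_pq; rewrite mnmBE mnm1E ?bimonomial_p ?bimonomial_q.
  by rewrite eq_sym (negPf pq) subn0.
by rewrite eqxx subn1.
Qed.

Definition bicurve : S := 'X_p ^+ a + 'X_q ^+ a + 'X_p ^+ b * 'X_q ^+ c.

Lemma bicurveE : bicurve = X a 0 + X 0 a + X b c.
Proof. by rewrite /bicurve /bimonomial !mpolyXn -!mpolyXD !mulm0n addm0 add0m. Qed.

Lemma bicurve_dp : bicurve^`M(p) = a%:R *: X a.-1 0 + b%:R *: X b.-1 c.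
Proof. by rewrite bicurveE !mderivD !deriv_bimonomial_p scale0r addr0. Qed.

Lemma bicurve_dq : bicurve^`M(q) = a%:R *: X 0 a.-1 + c%:R *: X b c.-1.
Proof. by rewrite bicurveE !mderivD !deriv_bimonomial_q scale0r add0r. Qed.

Lemma natr_neq0 n : (0 < n)%N -> n%:R != 0 :> F.
Proof. by move/pcharf0P: char0 => ->; rewrite -lt0n. Qed.

Definition standard_part i j : S := if standard a b c i j then X i j else 0.

(** One application of the relation f_x, after which the exponent of x is
    less than a - 1 or the monomial has been replaced by 0. *)
Definition reduce_p i j : S :=
  if i == a.-1 then - (b%:R / a%:R) *: standard_part b.-1 (c + j)
  else standard_part i j.

(** The normal form of x^i y^j.  Rewriting y^(a-1) by f_y can produce x^(a-1)
    (when i = a - 1 - b), which is why reduce_p is applied to the result; after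
    that the exponent of y is never a - 1 again unless the monomial is
    already in the ideal. *)
Definition reduce i j : S :=
  if j == a.-1 then - (c%:R / a%:R) *: reduce_p (b + i) c.-1
  else reduce_p i j.

Lemma standard_part0 i j : ~~ standard a b c i j -> standard_part i j = 0.
Proof. by rewrite /standard_part => /negPf ->. Qed.

Local Ltac nonstandard :=
  rewrite // ?standard_part0 ?scaler0 ?addr0 //; try (rewrite standardE; lia).

Local Ltac unfold_reduce :=
  rewrite /reduce /reduce_p; do ?case: eqP => ?; do ?nonstandard; try lia.

Lemma reduce_ge_p i j : (a <= i)%N -> reduce i j = 0.
Proof. by move=> ai; unfold_reduce. Qed.

Lemma reduce_ge_q i j : (a <= j)%N -> reduce i j = 0.
Proof. by move=> ai; unfold_reduce. Qed.

Lemma reduce_ge i j : (b <= i)%N -> (c <= j)%N -> reduce i j = 0.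
Proof. by move=> bi cj; unfold_reduce. Qed.

(** With reduce_dq, this makes the normal form vanish on all multiples of the
    derivatives: each term of a multiple of x f_x or of y f_y reduces to 0
    separately, so only y^l f_x and x^k f_y involve a cancellation. *)
Lemma reduce_dp l : a%:R *: reduce a.-1 l + b%:R *: reduce b.-1 (c + l) = 0.
Proof.
have a0 : a%:R != 0 :> F by apply: natr_neq0; lia.
have -> : reduce b.-1 (c + l) = standard_part b.-1 (c + l) by unfold_reduce.
rewrite /reduce; case: eqP => [->|_]; first by unfold_reduce.
by rewrite /reduce_p eqxx scalerA mulrN mulrC divfK // scaleNr addNr.
Qed.

Lemma reduce_dq k : a%:R *: reduce k a.-1 + c%:R *: reduce (b + k) c.-1 = 0.
Proof.
have a0 : a%:R != 0 :> F by apply: natr_neq0; lia.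
have -> : reduce (b + k) c.-1 = reduce_p (b + k) c.-1.
  by rewrite {1}/reduce; case: eqP => // ?; unfold_reduce.
by rewrite /reduce eqxx scalerA mulrN mulrC divfK // scaleNr addNr.
Qed.

Lemma reduce_standard i j : standard a b c i j -> reduce i j = X i j.
Proof.
move=> st; have := st; rewrite standardE => ?.
by rewrite /reduce /reduce_p /standard_part st; do 2?case: eqP => ?; try lia.
Qed.

Lemma reduce_supp i j k l : ~~ standard a b c k l -> (reduce i j)@_(bimonomial k l) = 0.
Proof.
move=> kl; have sp0 i' j' : (standard_part i' j')@_(bimonomial k l) = 0.
  rewrite /standard_part; case: ifP => st; last by rewrite mcoeff0.
  rewrite mcoeffX; case: eqP => // /bimonomial_inj[ei ej].
  by rewrite -ei -ej st in kl.
by rewrite /reduce /reduce_p; do 2?case: ifP; rewrite ?mcoeffZ sp0 ?mulr0.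
Qed.

(** Summing over exponents less than a loses nothing, because reduce vanishes
    on all other monomials (normal_formX), and makes linearity evident. *)
Definition normal_form P : S :=
  \sum_(i < a) \sum_(j < a) P@_(bimonomial i j) *: reduce i j.

Fact normal_form_is_linear : linear normal_form.
Proof.
move=> k P Q; rewrite /normal_form scaler_sumr -big_split; apply: eq_bigr => i _ /=.
rewrite scaler_sumr -big_split; apply: eq_bigr => j _ /=.
by rewrite mcoeffD mcoeffZ scalerDl scalerA.
Qed.

HB.instance Definition _ :=
  GRing.isLinear.Build F S S _ normal_form normal_form_is_linear.

Lemma normal_formX i j : normal_form (X i j) = reduce i j.
Proof.
rewrite /normal_form; case: (boolP ((i < a) && (j < a))%N) => [/andP[ia ja]|ij].
  rewrite (bigD1 (Ordinal ia)) //= (bigD1 (Ordinal ja)) //= mcoeffX eqxx scale1r.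
  rewrite !big1 ?addr0 // => [i' ii|j' jj].
    rewrite big1 // => j' _; rewrite mcoeffX; case: eqP => [/bimonomial_inj[ei _]|].
      by case/eqP: ii; apply: val_inj.
    by rewrite scale0r.
  rewrite mcoeffX; case: eqP => [/bimonomial_inj[ej]|].
    by case/eqP: jj; apply: val_inj.
  by rewrite scale0r.
rewrite big1 => [|i' _].
  by have [/reduce_ge_p ->|ia] := leqP a i => //; rewrite reduce_ge_q //; lia.
rewrite big1 // => j' _; rewrite mcoeffX; case: eqP => [/bimonomial_inj[ei ej]|].
  by rewrite ei ej !ltn_ord in ij.
by rewrite scale0r.
Qed.

Lemma normal_form_kills g :
  (forall i j, normal_form (X i j * g) = 0) -> forall P, normal_form (P * g) = 0.
Proof.
move=> kills P; rewrite (mpolyE P) mulr_suml linear_sum big1 // => m _ /=.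
by rewrite -scalerAl linearZ /= (bimonomialE m) kills scaler0.
Qed.

(** All three monomials of a multiple of the equation reduce to 0
    individually. *)
Lemma normal_form_curve P : normal_form (P * bicurve) = 0.
Proof.
apply: normal_form_kills => i j.
rewrite bicurveE !mulrDr !bimonomialM !linearD /= !normal_formX.
by rewrite reduce_ge_p ?[reduce _ (j + a)]reduce_ge_q ?reduce_ge ?addr0 ?leq_addl.
Qed.

Lemma normal_form_deriv P i : normal_form (P * bicurve^`M(i)) = 0.
Proof.
apply: normal_form_kills => k l; move: i; apply: ord2_pq.
  rewrite bicurve_dp mulrDr -!scalerAr !bimonomialM linearD !linearZ /= !normal_formX.
  rewrite addn0; case: k => [|k]; first by rewrite !add0n [(l + c)%N]addnC reduce_dp.
  rewrite reduce_ge_p; last lia.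
  rewrite reduce_ge; last lia.
    by rewrite !scaler0 addr0.
  lia.
rewrite bicurve_dq mulrDr -!scalerAr !bimonomialM linearD !linearZ /= !normal_formX.
rewrite addn0; case: l => [|l]; first by rewrite !add0n [(k + b)%N]addnC reduce_dq.
rewrite reduce_ge_q; last lia.
have [->|c0] := eqVneq c 0; first by rewrite scale0r scaler0 addr0.
rewrite reduce_ge; last lia.
  by rewrite !scaler0 addr0.
lia.
Qed.

(** In degree at least 2a one of the two exponents is at least a. *)
Lemma normal_form_order P : order_ge (2 * a) P -> normal_form P = 0.
Proof.
move=> ordP; rewrite /normal_form big1 // => i _; rewrite big1 // => j _.
rewrite ordP ?scale0r // mdeg_bimonomial.
by have := ltn_ord i; have := ltn_ord j; lia.
Qed.

Lemma normal_form_supp P k l :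
  ~~ standard a b c k l -> (normal_form P)@_(bimonomial k l) = 0.
Proof.
move=> kl; rewrite /normal_form raddf_sum big1 // => i _.
rewrite raddf_sum big1 // => j _.
by rewrite /= mcoeffZ reduce_supp // mulr0.
Qed.

Local Notation J := (jacobian_contraction bicurve O).

Lemma jacobian_monomialM i j k l : J (X i j) -> (i <= k)%N -> (j <= l)%N -> J (X k l).
Proof.
move=> Jij ik jl; rewrite -(subnK ik) -(subnK jl) -bimonomialM.
exact: jacobian_contractionMl.
Qed.

Lemma jacobian_unscale k P : k != 0 -> J (k *: P) -> J P.
Proof.
move=> k0 JP; rewrite -[P]scale1r -(mulVf k0) -scalerA.
exact: jacobian_contractionZ.
Qed.

Lemma jacobian_dp l : J (a%:R *: X a.-1 l + b%:R *: X b.-1 (c + l)).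
Proof.
have := jacobian_contractionMl (X 0 l) (jacobian_contraction_deriv bicurve O p).
by rewrite bicurve_dp mulrDr -!scalerAr !bimonomialM !add0n addn0 [(l + c)%N]addnC.
Qed.

Lemma jacobian_dq k : J (a%:R *: X k a.-1 + c%:R *: X (b + k) c.-1).
Proof.
have := jacobian_contractionMl (X k 0) (jacobian_contraction_deriv bicurve O q).
by rewrite bicurve_dq mulrDr -!scalerAr !bimonomialM !add0n addn0 [(k + b)%N]addnC.
Qed.

(** Euler's identity on the two homogeneous parts of the equation, of degrees
    a and b + c, isolates the second one. *)
Lemma jacobian_bc : J (X b c).
Proof.
apply: (@jacobian_unscale (b + c - a)%:R); first by apply: natr_neq0; rewrite subn_gt0.
have b0 : (0 < b)%N by lia.
have -> : (b + c - a)%:R *: X b c =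
  X 1 0 * bicurve^`M(p) + X 0 1 * bicurve^`M(q) - a%:R *: bicurve.
  rewrite bicurve_dp bicurve_dq bicurveE !mulrDr -!scalerAr !bimonomialM.
  rewrite !add0n !add1n (prednK b0) !(prednK (ltnW a_ge2)).
  have -> : c%:R *: X b (c.-1.+1) = c%:R *: X b c.
    by case: (c) => [|//]; rewrite !scale0r.
  rewrite natrB; last lia.
  rewrite natrD !scalerBl !scalerDl !scalerDr opprD opprD.
  set u := _ *: X a 0; set v := _ *: X 0 a; set w1 := b%:R *: _.
  set w2 := c%:R *: _; set w := a%:R *: _; ring.
apply: jacobian_contractionB; last exact/jacobian_contractionZ/jacobian_contraction_curve.
by apply: jacobian_contractionD; apply/jacobian_contractionMl/jacobian_contraction_deriv.
Qed.

(** Solves the relation k P + l Q = 0 for P, after replacing Q by a congruent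
    Q'. *)
Lemma jacobian_solve k l P Q Q' :
  k != 0 -> J (k *: P + l *: Q) -> J (Q - Q') -> J (P - - (l / k) *: Q').
Proof.
move=> k0 JPQ JQ.
have -> : P - - (l / k) *: Q' = k^-1 *: (k *: P + l *: Q) - (l / k) *: (Q - Q').
  rewrite scalerDr !scalerA mulVf // scale1r scaleNr opprK [l / k]mulrC scalerBr.
  by set u := _ *: Q; set v := _ *: Q'; ring.
by apply: jacobian_contractionB; apply: jacobian_contractionZ.
Qed.

(** Here f_x is x^(a-1) times a + b x^(b-a) y^c, whose value at the origin is
    a because b - a + c > 0. *)
Lemma jacobian_top l : (a <= b)%N -> J (X a.-1 l).
Proof.
move=> ab.
apply: (@jacobian_contraction_unit _ _ _ _
  (a%:R *: X 0 0 + b%:R *: X (b - a) c)).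
  rewrite meval_origin mcoeffD !mcoeffZ !mcoeffX -!mdeg_eq0 !mdeg_bimonomial.
  rewrite mulr1 (_ : (b - a + c == 0)%N = false) ?mulr0 ?addr0; last lia.
  by apply: natr_neq0; lia.
rewrite mulrDl -!scalerAl !bimonomialM !add0n.
rewrite (_ : (b - a + a.-1)%N = b.-1); last lia.
exact: jacobian_dp.
Qed.

(** For b < a, the difference of x f_x and a x^a is a multiple of x^b y^c. *)
Lemma jacobian_ge_p i j : (a <= i)%N -> J (X i j).
Proof.
move=> ai; have [ab|ba] := leqP a b.
  by apply: (jacobian_monomialM (jacobian_top j ab)) => //; lia.
apply: (@jacobian_monomialM a j) => //.
apply: (@jacobian_unscale a%:R); first by apply: natr_neq0; lia.
have := jacobian_contractionMl (X 1 0) (jacobian_dp j).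
rewrite mulrDr -!scalerAr !bimonomialM !add0n !add1n !prednK; try lia.
move=> JaX; rewrite -[_ *: X a j](addrK (b%:R *: X b (c + j))).
apply: jacobian_contractionB => //.
by apply/jacobian_contractionZ/(jacobian_monomialM jacobian_bc) => //; lia.
Qed.

Lemma jacobian_ge_q i j : (a <= j)%N -> J (X i j).
Proof.
move=> aj; apply: (@jacobian_monomialM i a) => //.
apply: (@jacobian_unscale a%:R); first by apply: natr_neq0; lia.
have := jacobian_contractionMl (X 0 1) (jacobian_dq i).
rewrite mulrDr -!scalerAr !bimonomialM !add0n !add1n prednK; last lia.
move=> JaX; rewrite -[_ *: X i a](addrK (c%:R *: X (b + i) (c.-1.+1))).
apply: jacobian_contractionB => //.
have [->|c0] := eqVneq c 0; first by rewrite scale0r; apply: jacobian_contraction0.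
apply/jacobian_contractionZ/(jacobian_monomialM jacobian_bc); lia.
Qed.

(** In y^(c+l) f_x the first monomial is a multiple of x^b y^c, so that the
    second one is in the ideal too. *)
Lemma jacobian_bumped_column l : (b < a)%N -> J (X b.-1 (c + (c + l))).
Proof.
move=> ba; apply: (@jacobian_unscale b%:R); first by apply: natr_neq0; lia.
rewrite -[_ *: _](addKr (a%:R *: X a.-1 (c + l))) addrC.
apply: jacobian_contractionB; first exact: jacobian_dp.
by apply/jacobian_contractionZ/(jacobian_monomialM jacobian_bc); lia.
Qed.

(** In x^(b-1) f_y the second monomial has x-exponent 2b - 1 >= a. *)
Lemma jacobian_corner : (b < a)%N -> J (X b.-1 a.-1).
Proof.
move=> ba; apply: (@jacobian_unscale a%:R); first by apply: natr_neq0; lia.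
rewrite -[_ *: _](addrK (c%:R *: X (b + b.-1) c.-1)).
apply: jacobian_contractionB; first exact: jacobian_dq.
by apply/jacobian_contractionZ/jacobian_ge_p; lia.
Qed.

Lemma standard_part_congr i j :
  (i < a.-1)%N -> (j < a.-1)%N -> J (X i j - standard_part i j).
Proof.
move=> ia ja; rewrite /standard_part; case: ifP => [_|].
  by rewrite subrr; apply: jacobian_contraction0.
rewrite standardE subr0 => /negbT nst.
have [ib|bi] := eqVneq i b.-1.
  by apply: (jacobian_monomialM (jacobian_bumped_column 0 _)); lia.
by apply: (jacobian_monomialM jacobian_bc); lia.
Qed.

(** The monomials to which reduce_p rewrites x^(a-1) y^l: here the exponent of
    y is not bounded by a - 2, and b may be at least a. *)
Lemma standard_part_congr_column l :
  J (X b.-1 (c + l) - standard_part b.-1 (c + l)).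
Proof.
rewrite /standard_part; case: ifP => [_|].
  by rewrite subrr; apply: jacobian_contraction0.
rewrite standardE subr0 => /negbT nst.
have [ab|ba] := leqP a b; first by apply: (jacobian_monomialM (jacobian_top 0 ab)); lia.
have [cl|lc] := leqP a.-1 (c + l).
  by apply: (jacobian_monomialM (jacobian_corner ba)); lia.
by apply: (jacobian_monomialM (jacobian_bumped_column 0 ba)); lia.
Qed.

Lemma reduce_p_congr i j : (j < a.-1)%N || (a <= i)%N -> J (X i j - reduce_p i j).
Proof.
move=> ij; rewrite /reduce_p; case: eqP => [->|ia].
  apply: jacobian_solve (standard_part_congr_column j); first by apply: natr_neq0; lia.
  exact: jacobian_dp.
have [ai|ai] := leqP a i; last by apply: standard_part_congr; lia.
rewrite standard_part0 ?subr0; first exact: jacobian_ge_p.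
by rewrite standardE; lia.
Qed.

Lemma reduce_congr i j : J (X i j - reduce i j).
Proof.
have [aj|ja] := leqP a j; first by rewrite reduce_ge_q // subr0; apply: jacobian_ge_q.
rewrite /reduce; case: eqP => [->|ja1]; last by apply: reduce_p_congr; lia.
have [c0|c0] := eqVneq c 0.
  have := jacobian_dq i; rewrite c0 mul0r oppr0 !scale0r subr0 addr0.
  by apply: jacobian_unscale; apply: natr_neq0; lia.
apply: (@jacobian_solve _ _ _ (X (b + i) c.-1)); first by apply: natr_neq0; lia.
  exact: jacobian_dq.
by apply: reduce_p_congr; lia.
Qed.

Lemma normal_form_congr P : J (P - normal_form P).
Proof.
have -> : P - normal_form P =
    \sum_(m <- msupp P) P@_m *: ('X_[m] - normal_form 'X_[m]).
  rewrite (eq_bigr (fun m => P@_m *: 'X_[m] - normal_form (P@_m *: 'X_[m]))).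
    by rewrite sumrB -(linear_sum normal_form) -mpolyE.
  by move=> m _; rewrite linearZ /= scalerBr.
apply: big_ind => [|Q R|m _]; first exact: jacobian_contraction0.
  exact: jacobian_contractionD.
apply: jacobian_contractionZ.
by rewrite (bimonomialE m) normal_formX; apply: reduce_congr.
Qed.

Lemma tjurina_number_bicurve :
  tjurina_number bicurve O (staircase_area a b c).
Proof.
pose ms := [seq bimonomial i j | i <- iota 0 a.-1, j <- iota 0 (height a b c i)].
have ms_standard m : (m \in ms) = standard a b c (m p) (m q).
  apply/allpairsPdep/idP => [[i [j [ia ja ->]]]|/andP[ia ja]].
    rewrite bimonomial_p bimonomial_q /standard.
    by rewrite !mem_iota !add0n /= in ia ja; rewrite ia ja.
  by exists (m p), (m q); rewrite !mem_iota -bimonomialE !add0n.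
have <- : size ms = staircase_area a b c.
  rewrite size_allpairs_dep sumnE big_map /staircase_area /index_iota subn0.
  by apply: eq_bigr => i _; rewrite size_iota.
apply: (@tjurina_number_normal_form _ _ normal_form _ (2 * a)).
- apply: allpairs_uniq_dep => [|i _|[i j] [k l] _ _ /= /bimonomial_inj[-> ->] //].
    exact: iota_uniq.
  exact: iota_uniq.
- exact: normal_form_congr.
- move=> m; rewrite ms_standard => st.
  by rewrite {1}(bimonomialE m) /= normal_formX reduce_standard // -bimonomialE.
- move=> P m; rewrite ms_standard => nst; rewrite (bimonomialE m).
  exact: normal_form_supp.
- exact: normal_form_curve.
- exact: normal_form_deriv.
- exact: normal_form_order.
Qed.

End NormalForm.

(** * Linear forms of the tangent cone *)

Section Tangent.
Variable F : fieldType.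
Local Notation S := {mpoly F[2]}.
Local Notation O := (origin F).

Lemma translate_origin (f : S) : translate f O = f.
Proof.
rewrite /translate -[RHS]comp_mpoly_id; congr (_ \mPo _).
by apply: eq_from_tnth => i; rewrite !tnth_mktuple mpolyC0 addr0.
Qed.

Lemma curveE a b c : curve F a b c = bicurve F 0 1 a b c.
Proof. by []. Qed.

Lemma curve_swap a b c : curve F a b c = bicurve F 1 0 a c b.
Proof. by rewrite curveE /bicurve ['X_1 ^+ a + _]addrC ['X_1 ^+ c * _]mulrC. Qed.

Lemma tangent_cone_curve a b c d : (a < b + c)%N -> (d <= a)%N ->
  tangent_cone (curve F a b c) O d = if d == a then 'X_0 ^+ a + 'X_1 ^+ a else 0.
Proof.
move=> abc da; rewrite /tangent_cone translate_origin curveE bicurveE.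
rewrite !pihomogD !pihomogX /= !mdeg_bimonomial addn0 add0n [d == a]eq_sym.
rewrite [(b + c)%N == d]gtn_eqF ?addr0; last lia.
case: eqP => _; last by rewrite addr0.
by rewrite /bimonomial !mpolyXn !mulm0n addm0 add0m.
Qed.
End Tangent.

(** Evaluating the factorisation of X^n + 1 at x / y and multiplying by y^n. *)
Lemma homogenize_Xn_add_1 (F K : fieldType) (iota : {rmorphism F -> K}) n
    (s : seq F) (x y : K) :
  'X^n + 1 = \prod_(z <- s) ('X - z%:P) -> y != 0 -> size s = n ->
  x ^+ n + y ^+ n = \prod_(z <- s) (x - iota z * y).
Proof.
move=> splits y0 sz.
have := congr1 (fun g : {poly K} => g.[x / y]) (congr1 (map_poly iota) splits).
rewrite /= rmorphD rmorph1 /= map_polyXn rmorph_prod horner_prod !hornerE => eq_xy.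
transitivity (\prod_(z <- s) y * \prod_(z <- s) (x / y - iota z)).
  rewrite big_const_seq count_predT sz iter_mulr_1.
  rewrite (eq_bigr (fun z => (map_poly iota ('X - z%:P)).[x / y])).
    by rewrite -eq_xy mulrDr mulr1 expr_div_n mulrC divfK // expf_neq0.
  by move=> z _; rewrite rmorphB /= map_polyX map_polyC !hornerE.
by rewrite -big_split; apply: eq_bigr => z _ /=; field.
Qed.

Lemma separable_Xn_add_1 (F : fieldType) n :
  n%:R != 0 :> F -> separable_poly ('X^n + 1 : {poly F}).
Proof.
case: n => [/eqP// | n nz_n]; rewrite unlock derivD /= derivC addr0.
rewrite derivXn -scaler_nat coprimepZr //= exprS coprimep_sym.
by rewrite coprimep_addl_mul coprimep1.
Qed.

Section Ordinary.
Variable F : closedFieldType.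
Local Notation S := {mpoly F[2]}.
Local Notation O := (origin F).

Lemma fermat_factor n : n%:R != 0 :> F ->
  exists2 s : seq F, uniq s & size s = n /\
    'X_0 ^+ n + 'X_1 ^+ n = \prod_(z <- s) ('X_0 - z *: 'X_1) :> S.
Proof.
move=> n0; have n_gt0 : (0 < n)%N by case: n n0 => //; rewrite eqxx.
have [s] := closed_field_poly_normal ('X^n + 1 : {poly F}).
rewrite lead_coefDl ?size_polyXn ?size_poly1 // lead_coefXn scale1r => splits.
exists s; first by rewrite -separable_prod_XsubC -splits separable_Xn_add_1.
have sz : size s = n.
  apply/eqP; rewrite -eqSS -(size_prod_XsubC s id) -splits.
  by rewrite size_polyDl size_polyXn ?size_poly1.
split=> //; apply/eqP; rewrite -tofrac_eq; apply/eqP.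
pose iota : {rmorphism F -> {fraction S}} := @tofrac S \o @mpolyC 2 F.
rewrite tofracD !tofracXn rmorph_prod (homogenize_Xn_add_1 iota _ splits) //.
  by apply: eq_bigr => z _; rewrite -mul_mpolyC rmorphB rmorphM.
rewrite tofrac_eq0; apply/negP => /eqP /(congr1 (mcoeff U_(1))) /eqP.
by rewrite mcoeffXU eqxx mcoeff0 oner_eq0.
Qed.

Lemma ordinary_singularity_curve a b c : a%:R != 0 :> F -> (a < b + c)%N ->
  ordinary_singularity (curve F a b c) O a.
Proof.
move=> a0 abc; have a_gt0 : (0 < a)%N by case: a a0 {abc} => //; rewrite eqxx.
have [s s_uniq [sz factor]] := fermat_factor a0.
split; first split.
- rewrite tangent_cone_curve // eqxx => /(congr1 (mcoeff (U_(0) *+ a))).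
  rewrite mcoeffD !mcoeffXn eqxx mcoeff0.
  rewrite (_ : (_ == _) = false) ?addr0; first by apply/eqP/oner_neq0.
  apply/eqP => /(congr1 (fun m : 'X_{1..2} => m 0)).
  by rewrite !mulmnE !mnm1E mul1n mul0n => a00; rewrite -a00 in a_gt0.
- by move=> d da; rewrite tangent_cone_curve ?ltn_eqF // ltnW.
exists (fun i => 'X_0 - s`_i *: 'X_1); split.
- move=> i; rewrite rpredB ?rpredZ //; by rewrite dhomogX /= mdeg1.
- move=> i j k eq_l.
  have := congr1 (mcoeff U_(0)) eq_l; have := congr1 (mcoeff U_(1)) eq_l.
  rewrite !(mcoeffB, mcoeffZ, mcoeffXU) /= !mulr0 !mulr1 !subr0 !sub0r mulr1.
  move=> eq_z k1; move: eq_z; rewrite -k1 mul1r => /oppr_inj /eqP.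
  by rewrite nth_uniq ?sz // => /eqP; apply: val_inj.
rewrite tangent_cone_curve // eqxx factor (big_nth 0) big_mkord sz.
by [].
Qed.
End Ordinary.

(** * The area of the staircase *)

Lemma sum_height_ge a b c : (a <= b)%N ->
  (\sum_(0 <= i < a.-1) height a b c i = a.-1 * a.-1)%N.
Proof.
move=> ab; rewrite (eq_big_nat _ _ (F2 := fun=> a.-1)) => [|i ia].
  by rewrite sum_nat_const_nat subn0.
rewrite /height; case: ltngtP => //= ?; lia.
Qed.

Lemma sum_height_lt a b c : (0 < b < a)%N ->
  (\sum_(0 <= i < a.-1) height a b c i =
   b.-1 * a.-1 + minn a.-1 (2 * c) + (a.-1 - b) * c)%N.
Proof.
case: b => [//|b] ba; rewrite (big_cat_nat (n := b.+1)) //=; last lia.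
rewrite big_nat_recr //= {2}/height ltnn eqxx.
congr (_ + _ + _)%N.
  rewrite (eq_big_nat _ _ (F2 := fun=> a.-1)) => [|i /andP[_ ib]].
    by rewrite sum_nat_const_nat subn0.
  by rewrite /height ib.
rewrite (eq_big_nat _ _ (F2 := fun=> c)) => [|i ia].
  by rewrite sum_nat_const_nat.
by rewrite /height; case: ltngtP => //= ?; lia.
Qed.

Lemma staircase_area_cases a b c : (2 <= a)%N -> (c <= b)%N -> (a < b + c)%N ->
  [\/ (a <= b)%N /\ staircase_area a b c = (a.-1 * a.-1)%N,
      [/\ b < a, 2 * c < a &
          staircase_area a b c = b.-1 * a.-1 + 2 * c + (a.-1 - b) * c]%N
    | [/\ b < a, a <= 2 * c &
          staircase_area a b c = b.-1 * a.-1 + a.-1 + (a.-1 - b) * c]%N].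
Proof.
move=> a2 cb abc; rewrite /staircase_area; have [ab|ba] := leqP a b.
  by apply: Or31; rewrite sum_height_ge.
rewrite sum_height_lt; last lia.
have [ac|ca] := leqP a (2 * c).
  by apply: Or33; split=> //; rewrite (minn_idPl _) //; lia.
by apply: Or32; split=> //; rewrite (minn_idPr _) //; lia.
Qed.

Lemma staircase_area_formula a b c : (2 <= a)%N -> (c <= b)%N -> (a < b + c)%N ->
  [\/ (a <= b \/ (b = a.-1 /\ a <= 2 * c))%N /\
      (staircase_area a b c)%:Z = ((a%:Z - 1) ^+ 2)%R,
      [/\ a + 1 < 2 * b, b <= a.-1 & 2 * c <= a.-1]%N /\
      (staircase_area a b c)%:Z = (b%:Z * (a%:Z - 1) + c%:Z * (a%:Z + 1)
                        - b%:Z * c%:Z - a%:Z + 1)%R,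
      [/\ a + 1 < 2 * b, b < a.-1 & 2 * c = a]%N /\
      (staircase_area a b c)%:Z = (b%:Z * (a%:Z - 1) + c%:Z * (a%:Z + 1)
                        - b%:Z * c%:Z - a%:Z)%R
    | [/\ a + 1 <= 2 * b, b < a.-1, a + 1 <= 2 * c & c < a.-1]%N /\
      (staircase_area a b c)%:Z = (b%:Z * (a%:Z - 1) + c%:Z * (a%:Z - 1)
                        - b%:Z * c%:Z)%R].
Proof.
move=> a2 cb abc.
case: (staircase_area_cases a2 cb abc) => [[ab ->]|[ba ca ->]|[ba ac ->]].
- by apply: Or41; split; [left | nia].
- by apply: Or42; split; [split; lia | nia].
have [ba1|ba1] := eqVneq b a.-1.
  by apply: Or41; split; [right; split; lia | nia].
have [ca|ca] := eqVneq (2 * c)%N a.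
  by apply: Or43; split; [split; lia | nia].
by apply: Or44; split; [split; lia | nia].
Qed.

(** For odd a both exponents equal (a + 1) / 2, for even a they are a / 2 + 1
    and a / 2. *)
Definition best_b a := (a %/ 2 + 1)%N.
Definition best_c a := ((a + 1) %/ 2)%N.

Lemma parityP n : exists k,
  n = (2 * k)%N /\ odd n = false \/ n = (2 * k + 1)%N /\ odd n = true.
Proof.
exists (n %/ 2)%N.
by have [on|on] := boolP (odd n); [right|left]; split=> //; lia.
Qed.

Lemma best_staircase_area a : (2 <= a)%N ->
  (4 * staircase_area a (best_b a) (best_c a) + odd a + 4 + 2 * a = 3 * a ^ 2)%N.
Proof.
move=> a2; rewrite /best_b /best_c.
have := @staircase_area_cases a (a %/ 2 + 1) ((a + 1) %/ 2) a2.
have [k [[ak ->]|[ak ->]]] := parityP a.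
  have -> : (a %/ 2 + 1 = k + 1)%N by lia.
  have -> : ((a + 1) %/ 2 = k)%N by lia.
  by case; try lia; rewrite ak => -[*]; nia.
have -> : (a %/ 2 + 1 = k + 1)%N by lia.
have -> : ((a + 1) %/ 2 = k + 1)%N by lia.
by case; try lia; rewrite ak => -[*]; nia.
Qed.

(** With e = a - b and A = a - 1, the constraint c >= e + 1 bounds four times
    the area below by 3 A^2 + 4 A + (2 e - A + 2)^2, which exceeds four times
    the claimed minimum for every e. *)
Lemma low_staircase_bound a b c : (2 <= a)%N -> (c <= b)%N -> (a < b + c)%N ->
  (b < a)%N -> (2 * c < a)%N ->
  (3 * a ^ 2 < 4 * (b.-1 * a.-1 + 2 * c + (a.-1 - b) * c) + 2 * a + 4)%N.
Proof.
move=> a2 cb abc ba ca.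
have [p ap] : exists p, a = (b + 1 + p)%N by exists (a - b - 1)%N; lia.
have [t ct] : exists t, c = (p + 2 + t)%N by exists (c - p - 2)%N; lia.
have [b' bb] : exists b', b = b'.+1 by exists b.-1; lia.
subst c a b.
have -> : (b'.+1 + 1 + p).-1 = (b' + 1 + p)%N by lia.
have -> : (b' + 1 + p - b'.+1 = p)%N by lia.
rewrite /=.
(* This is 2 e - A + 2 for e = p + 1 and A = b' + 1 + p. *)
have := sqr_ge0 (p%:Z - b'%:Z + 3); nia.
Qed.

(** The area is (a-1)^2 - p r with p = a - 1 - b and r = p + t = a - 1 - c.
    From 4 p r = (p + r)^2 - t^2 and p + r = a - 3 - s one reads off how far
    the area is from its minimum in terms of t and s. *)
Lemma high_staircase_excess a b c : (2 <= a)%N -> (c <= b)%N -> (a < b + c)%N ->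
  (b < a)%N -> (a <= 2 * c)%N ->
  exists p t s, [/\ a = b + 1 + p, b = c + t, b + c = a + 1 + s &
   4 * (b.-1 * a.-1 + a.-1 + (a.-1 - b) * c) + 5 + 2 * a =
   3 * a ^ 2 + t ^ 2 + s * (4 * p + 2 * t + s)]%N.
Proof.
move=> a2 cb abc ba ac.
have [p ap] : exists p, a = (b + 1 + p)%N by exists (a - b - 1)%N; lia.
have [t bt] : exists t, b = (c + t)%N by exists (b - c)%N; lia.
have [s cs] : exists s, c = (p + 2 + s)%N by exists (c - p - 2)%N; lia.
exists p, t, s; split=> //; first by lia.
subst b a c.
have -> : (p + 2 + s + t + 1 + p).-1 = (p + 2 + s + t + p)%N by lia.
have -> : (p + 2 + s + t).-1 = (p + 1 + s + t)%N by lia.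
have -> : (p + 2 + s + t + p - (p + 2 + s + t) = p)%N by lia.
rewrite !expnS !expn0; ring.
Qed.

Lemma full_square_bound a : (2 <= a)%N ->
  (3 * a ^ 2 <= 4 * (a.-1 * a.-1) + odd a + 2 * a + 4)%N /\
  ((5 <= a)%N -> (3 * a ^ 2 < 4 * (a.-1 * a.-1) + odd a + 2 * a + 4)%N).
Proof.
case: a => [|[|[|[|[|a]]]]] // _.
by split=> [|_]; rewrite /= !expnS !expn0; nia.
Qed.

Lemma best_staircase_le a b c : (2 <= a)%N -> (c <= b)%N -> (a < b + c)%N ->
  (staircase_area a (best_b a) (best_c a) <= staircase_area a b c)%N.
Proof.
move=> a2 cb abc; have := best_staircase_area a2.
move: (staircase_area a (best_b a) _) => t0.
case: (staircase_area_cases a2 cb abc) => [[ab ->]|[ba ca ->]|[ba ac ->]].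
- have [+ _] := full_square_bound a2; move: (a ^ 2)%N (a.-1 * a.-1)%N => u v; lia.
- have := low_staircase_bound a2 cb abc ba ca.
  by move: (a ^ 2)%N (b.-1 * _ + _ + _)%N => u v; lia.
have [p [t [s [_ _ _]]]] := high_staircase_excess a2 cb abc ba ac.
move: (a ^ 2)%N (b.-1 * _ + _ + _)%N (t ^ 2)%N (s * _)%N => u v w x; lia.
Qed.

(** The excess t^2 + s (4 p + 2 t + s) has to be 0 for odd a and 1 for even a,
    which gives s = 0 with t = 0 or 1; the solution s = 1, p = t = 0 has
    a = 4. *)
Lemma best_staircase_unique a b c : (5 <= a)%N -> (c <= b)%N -> (a < b + c)%N ->
  staircase_area a b c = staircase_area a (best_b a) (best_c a) ->
  b = best_b a /\ c = best_c a.
Proof.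
move=> a5 cb abc; have a2 : (2 <= a)%N by lia.
have := best_staircase_area a2.
move: (staircase_area a (best_b a) _) => t0 + area_t0; rewrite -{}area_t0.
case: (staircase_area_cases a2 cb abc) => [[ab ->]|[ba ca ->]|[ba ac ->]].
- have [_ /(_ a5)] := full_square_bound a2; move: (a ^ 2)%N (a.-1 * a.-1)%N => u v; lia.
- have := low_staircase_bound a2 cb abc ba ca.
  by move: (a ^ 2)%N (b.-1 * _ + _ + _)%N => u v; lia.
have [p [t [s [ap bt abs]]]] := high_staircase_excess a2 cb abc ba ac.
move=> eq1 eq2.
have {eq1 eq2} : (t ^ 2 + s * (4 * p + 2 * t + s) + odd a = 1)%N.
  by move: (a ^ 2)%N (b.-1 * _ + _ + _)%N (t ^ 2)%N (s * _)%N eq1 eq2 => u v w x; lia.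
rewrite /best_b /best_c; case: s abs => [|[|s]] abs; [|lia|lia].
by case: t bt => [|[|t]] bt; lia.
Qed.

(** * Tjurina numbers of the curves *)

Lemma tjurina_number_curve (F : fieldType) a b c :
  [pchar F] =i pred0 -> (2 <= a)%N -> (a < b + c)%N ->
  tjurina_number (curve F a b c) (origin F) (staircase_area a (maxn b c) (minn b c)).
Proof.
move=> char0 a2 abc; have [bc|cb] := leqP b c.
  by rewrite curve_swap; apply: tjurina_number_bicurve => //; lia.
by rewrite curveE; apply: tjurina_number_bicurve => //; lia.
Qed.

Local Close Scope ring_scope.

Theorem theorem5p7 (R : realType) (a : nat) (ha : 2 <= a) :
  [/\ forall b c : nat, a < b + c ->
        ordinary_singularity (curve R[i] a b c) (origin R[i]) a /\
        exists tau : nat, tjurina_number (curve R[i] a b c) (origin R[i]) tau,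
      forall b c tau : nat, a < b + c -> c <= b ->
        tjurina_number (curve R[i] a b c) (origin R[i]) tau ->
        [\/ (a <= b \/ (b = a.-1 /\ a <= 2 * c)) /\
            tau%:Z%R = ((a%:Z - 1) ^+ 2)%R,
            [/\ a + 1 < 2 * b, b <= a.-1 & 2 * c <= a.-1] /\
            tau%:Z%R = (b%:Z * (a%:Z - 1) + c%:Z * (a%:Z + 1)
                        - b%:Z * c%:Z - a%:Z + 1)%R,
            [/\ a + 1 < 2 * b, b < a.-1 & 2 * c = a] /\
            tau%:Z%R = (b%:Z * (a%:Z - 1) + c%:Z * (a%:Z + 1)
                        - b%:Z * c%:Z - a%:Z)%R
          | [/\ a + 1 <= 2 * b, b < a.-1, a + 1 <= 2 * c & c < a.-1] /\
            tau%:Z%R = (b%:Z * (a%:Z - 1) + c%:Z * (a%:Z - 1)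
                        - b%:Z * c%:Z)%R]
    & exists tau_a : nat,
      [/\ tau_a%:Z%R = ((3 * a%:Z ^+ 2 - 2 * a%:Z - 4)%R %/ 4)%Z,
          (exists b c : nat, a < b + c /\
             tjurina_number (curve R[i] a b c) (origin R[i]) tau_a)
          /\ (forall b c tau : nat, a < b + c ->
             tjurina_number (curve R[i] a b c) (origin R[i]) tau ->
             tau_a <= tau),
          ~~ odd a ->
            tjurina_number (curve R[i] a (a %/ 2 + 1) (a %/ 2)) (origin R[i])
              tau_a,
          odd a ->
            tjurina_number (curve R[i] a ((a + 1) %/ 2) ((a + 1) %/ 2))
              (origin R[i]) tau_a
        & 5 <= a -> forall b c : nat, a < b + c -> c <= b ->
            tjurina_number (curve R[i] a b c) (origin R[i]) tau_a ->
            if odd a then b = (a + 1) %/ 2 /\ c = (a + 1) %/ 2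
            else b = a %/ 2 + 1 /\ c = a %/ 2]].
Proof.
have char0 : [pchar R[i]]%R =i pred0 := pchar_num _.
have a_neq0 : (a%:R != 0 :> R[i])%R by rewrite pnatr_eq0 -lt0n ltnW.
have tjurina b c : a < b + c ->
    tjurina_number (curve R[i] a b c) (origin R[i])
      (staircase_area a (maxn b c) (minn b c)).
  exact: tjurina_number_curve.
have tauE b c t : a < b + c ->
    tjurina_number (curve R[i] a b c) (origin R[i]) t ->
    t = staircase_area a (maxn b c) (minn b c).
  by move=> abc tj; apply: tjurina_number_unique tj (tjurina _ _ abc).
have best_gt : a < best_b a + best_c a by rewrite /best_b /best_c; lia.
have best_le : best_c a <= best_b a by rewrite /best_b /best_c; lia.
have tj_best : tjurina_number (curve R[i] a (best_b a) (best_c a)) (origin R[i])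
    (staircase_area a (best_b a) (best_c a)).
  by have := tjurina _ _ best_gt; rewrite (maxn_idPl best_le) (minn_idPr best_le).
split.
- move=> b c abc; split; first exact: ordinary_singularity_curve.
  by exists (staircase_area a (maxn b c) (minn b c)); apply: tjurina.
- move=> b c t abc cb /(tauE _ _ _ abc) ->.
  rewrite (maxn_idPl cb) (minn_idPr cb); exact: staircase_area_formula.
exists (staircase_area a (best_b a) (best_c a)); split.
- by have := best_staircase_area ha; rewrite /exprz; lia.
- split; first by exists (best_b a), (best_c a).
  move=> b c t abc /(tauE _ _ _ abc) ->.
  by apply: best_staircase_le => //; lia.
- move=> a_even; have <- : best_b a = a %/ 2 + 1 by [].
  by have <- : best_c a = a %/ 2 by rewrite /best_c; lia.
- move=> a_odd; have <- : best_c a = (a + 1) %/ 2 by [].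
  by have {1}<- : best_b a = best_c a by rewrite /best_b /best_c; lia.
move=> a5 b c abc cb /(tauE _ _ _ abc).
rewrite (maxn_idPl cb) (minn_idPr cb) => /esym /(best_staircase_unique a5 cb abc)[-> ->].
by rewrite /best_b /best_c; case: ifP => a_odd; lia.
Qed.
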